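(* (Second Pieri rule.) Let $n$ be a positive integer, let $\mu$ be a (positive) partition, and let $u,x_1,\dots,x_n$ be complex numbers with $su\ne1$. Then $$ \sum_{\lambda} \mathbb{F}_{\lambda}(x_1,\dots,x_n)\, \widetilde{\mathsf F}^{*}_{\lambda'/\mu'}(u) = \left(1+\frac{u(1-s^2)}{1-su}\sum_{i=1}^{n}\left(\frac{u-s}{1-su}\right)^{i-1}\mathbb{F}_{1^i}(x_1,\dots,x_n)\right) \mathbb{F}_{\mu}(x_1,\dots,x_n), $$ where the left-hand sum is over all (positive) partitions $\lambda$ and $1^i$ denotes the partition with exactly $i$ parts, all equal to $1$.
   Context: Fix $q,s\in\mathbb{C}$ with $|q|<1$, $|s|<1$. Write $(a;q)_m=\prod_{i=1}^m(1-aq^{i-1})$ for $m\ge 1$, $(a;q)_0=1$. A (positive) partition is a finite, possibly empty, sequence $\lambda_1\ge\dots\ge\lambda_\ell\ge1$ of integers, with $\lambda_i:=0$ for $i>\ell$; $m_i(\lambda)=\#\{j:\lambda_j=i\}$ for $i\ge1$; $\lambda'$ is the conjugate partition, so $m_i(\lambda')=\lambda_i-\lambda_{i+1}$. Put $\tilde c_{\lambda}=\prod_{i\ge1}\frac{(s^2;q)_{m_i(\lambda)}}{(q;q)_{m_i(\lambda)}}$. Spin $q$-Whittaker polynomials. For $x\in\mathbb{C}$ and $i,j,k,\ell\in\mathbb{Z}_{\ge0}$, $$W_x(i,j;k,\ell)=\mathbf 1_{i+j=k+\ell}\,\mathbf 1_{i\ge\ell}\;x^\ell\frac{(-s/x;q)_\ell\,(-sx;q)_{i-\ell}\,(q;q)_k}{(q;q)_\ell\,(q;q)_{i-\ell}\,(s^2;q)_k},$$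 where $x^\ell(-s/x;q)_\ell$ is read as $\prod_{r=0}^{\ell-1}(x+sq^r)$. For a partition $\lambda$, $$\mathbb{F}_{\lambda}(x_1,\dots,x_n)=\sum\prod_{r=1}^n\left[x_r^{h_{r,0}}\frac{(-s/x_r;q)_{h_{r,0}}}{(q;q)_{h_{r,0}}}\prod_{c\ge1}W_{x_r}\big(v_{r-1,c},h_{r,c-1};v_{r,c},h_{r,c}\big)\right],$$ the sum running over all non-negative integers $h_{r,c}$ ($1\le r\le n$, $c\ge0$), with $h_{r,c}=0$ for all large $c$, and $v_{r,c}$ ($0\le r\le n$, $c\ge1$) subject to $v_{0,c}=0$ and $v_{n,c}=\lambda_c-\lambda_{c+1}$ (all but finitely many weights equal $1$ in any nonzero term). One-variable skew stable spin Hall--Littlewood functions. For $i,k\in\mathbb{Z}_{\ge0}$ and $j,\ell\in\{0,1\}$ let $w_u(i,j;k,\ell)$ be zero unless $i+j=k+\ell$, and for $g\in\mathbb{Z}_{\ge0}$ $$w_u(g,0;g,0)=\tfrac{1-sq^gu}{1-su},\quad w_u(g+1,0;g,1)=\tfrac{(1-s^2q^g)u}{1-su},\quad w_u(g,1;g+1,0)=\tfrac{1-q^{g+1}}{1-su},\quad w_u(g,1;g,1)=\tfrac{u-sq^g}{1-su}.$$ For partitions $\lambda,\mu$ put $$\widetilde{\mathsf F}_{\lambda/\mu}(u)=\sum_{h_0,h_1,\ldots}u^{h_0}\prod_{c\ge1}w_u\big(m_c(\mu),h_{c-1};m_c(\lambda),h_c\big),\qquad \widetilde{\mathsf F}^*_{\lambda/\mu}(u)=\frac{\tilde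 c_\lambda}{\tilde c_\mu}\widetilde{\mathsf F}_{\lambda/\mu}(u),$$ the sum being over sequences $h_c\in\{0,1\}$ with $h_c=0$ for all large $c$. *)

(* Defs.v *)
From HB Require Import structures.
From mathcomp Require Import all_boot all_order all_algebra.
From mathcomp Require Import boolp classical_sets functions cardinality fsbigop.
From mathcomp Require Import reals complex.

Set Implicit Arguments.
Unset Strict Implicit.
Unset Printing Implicit Defensive.

Import GRing.Theory Num.Theory.

Local Open Scope classical_set_scope.
Local Open Scope ring_scope.

(* A partition is the sequence of its nonzero parts, in weakly decreasing
   order; [nth 0 la i] is the (i+1)-st part, and is 0 beyond the length. *)
Definition is_part (la : seq nat) : bool :=
  sorted geq la && (0%N \notin la).

Definition partitions : set (seq nat) := [set la | is_part la].

Definition conj_part (la : seq nat) : seq nat :=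
  [seq count (fun p => (j <= p)%N) la | j <- iota 1 (head 0%N la)].

Section Functions.
Variable C : fieldType.
Implicit Types (q s u x a : C) (la mu : seq nat).

(* The product a 0 * a 1 * a 2 * ... of a sequence whose partial products are
   eventually constant, defined as their eventual value (and 0 if there is
   none). It covers the products where almost all factors are 1 and those
   where some factor is 0. *)
Definition infprod (a : nat -> C) : C :=
  xget 0 [set p | exists N : nat, forall M : nat,
                    (N <= M)%N -> \prod_(c < M) a c = p].

Definition eventually0 (h : nat -> nat) : Prop :=
  exists N : nat, forall c : nat, (N <= c)%N -> h c = 0%N.

Definition qpoch q a (m : nat) : C := \prod_(i < m) (1 - a * q ^+ i).

(* x ^ l * (- s / x; q)_l, as a polynomial in x *)
Definition xqpoch q s x (l : nat) : C := \prod_(r < l) (x + s * q ^+ r).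

Definition weightW q s x (i j k l : nat) : C :=
  if (i + j == k + l)%N && (l <= i)%N then
    xqpoch q s x l * qpoch q (- (s * x)) (i - l) * qpoch q q k
    / (qpoch q q l * qpoch q q (i - l) * qpoch q (s ^+ 2) k)
  else 0.

(* [h r c] is h_{r+1,c}, while [v r c] is v_{r,c+1}. *)
Definition qW_config (n : nat) : Type :=
  (('I_n -> nat -> nat) * ('I_n.+1 -> nat -> nat))%type.

Definition qW_configs (n : nat) la : set (qW_config n) :=
  [set hv | [/\ forall r, eventually0 (hv.1 r),
                forall c, hv.2 ord0 c = 0%N &
                forall c, hv.2 ord_max c = (nth 0 la c - nth 0 la c.+1)%N]].

(* [widen_ord (leqnSn n) r] and [lift ord0 r] have the values r and r + 1.
   If the partial products over c do not stabilize for some r, then the labels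
   hv.2 below that row have infinite support; as those of ord0 are 0 and h is
   eventually 0, a lower row has a zero weight, so the term is 0 as it should
   be. *)
Definition qW_term q s (n : nat) (x : 'I_n -> C) (hv : qW_config n) : C :=
  \prod_(r < n)
    (xqpoch q s (x r) (hv.1 r 0%N) / qpoch q q (hv.1 r 0%N) *
     infprod (fun c => weightW q s (x r)
       (hv.2 (widen_ord (leqnSn n) r) c) (hv.1 r c)
       (hv.2 (lift ord0 r) c) (hv.1 r c.+1))).

(* The sum has finite support: the labels v r c of a nonzero term are the
   differences of consecutive parts of partitions contained in la, and they
   determine the labels h r c. *)
Definition spin_qWhittaker q s (n : nat) (x : 'I_n -> C) la : C :=
  \sum_(hv \in @qW_configs n la) qW_term q s x hv.

Definition ctilde q s la : C :=
  infprod (fun i => qpoch q (s ^+ 2) (count_mem i.+1 la)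
                    / qpoch q q (count_mem i.+1 la)).

Definition weightw q s u (i : nat) (j : bool) (k : nat) (l : bool) : C :=
  if (i + j == k + l)%N then
    match j, l with
    | false, false => (1 - s * q ^+ i * u) / (1 - s * u)
    | false, true => (1 - s ^+ 2 * q ^+ k) * u / (1 - s * u)
    | true, false => (1 - q ^+ k) / (1 - s * u)
    | true, true => (u - s * q ^+ i) / (1 - s * u)
    end
  else 0.

(* Here the summation has at most one nonzero term, since the condition
   i + j = k + l determines h c from h c.+1. *)
Definition spinHL q s u la mu : C :=
  \sum_(h \in [set h : nat -> bool | eventually0 h])
    (u ^+ h 0%N *
     infprod (fun c => weightw q s u (count_mem c.+1 mu) (h c)
                                     (count_mem c.+1 la) (h c.+1))).

Definition spinHL_dual q s u la mu : C :=
  ctilde q s la / ctilde q s mu * spinHL q s u la mu.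

End Functions.

(* Main.v *)
(* Each variable x contributes the factor (1 + u x) / (1 - s u): the branching
   rule of F reduces this to a commutation relation between the one-variable
   skew functions of F and of the dual Hall-Littlewood functions. In that
   relation la = mu + e on the left and ka = nu - d on the right, with e and d
   sequences of bits, so both sides are products of 2 x 2 transfer matrices over
   the columns; the two partial products from column c on are related linearly
   by a matrix that depends only on mu_c - nu_c. The case mu = 0, where only the
   partitions la = 1^i contribute, turns the product of the factors
   (1 + u x_i) / (1 - s u) into the sum of the statement. *)

Require Import Defs.
From HB Require Import structures.
From mathcomp Require Import all_boot all_order all_algebra.
From mathcomp Require Import boolp classical_sets functions cardinality fsbigop.
From mathcomp Require Import reals complex.
From mathcomp Require Import zify ring.

Set Implicit Arguments.
Unset Strict Implicit.
Unset Printing Implicit Defensive.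

Import GRing.Theory Num.Theory.

Local Open Scope classical_set_scope.
Local Open Scope ring_scope.

(** The dual normalization makes both sides of the commutation relation local in the columns. The
    denominators of the one-variable skew function F_{la/nu} multiply up to ctilde of la', the
    numerator of the dual function of la'/mu', so only 1/ctilde of mu' is left. On the other side
    the denominators of F_{mu/ka} give the same prefactor, and ctilde of nu' over ctilde of ka'
    splits into one ratio per column. The comparison runs from the far columns, where all parts are
    zero, back to column 0, where the edge h_0 carries the weight u^{h_0}.

    Not every bit sequence turns a partition into a partition: before a sum over partitions becomes
    a matrix product, the bad sequences must be shown to have weight zero. The induction on the
    number of variables takes all its sums over one box of partitions that contains the relevant
    supports, so every exchange of sums is finite. *)

(** * Products and sums of finite support, and path sums *)

Section Sums.
Variable C : fieldType.

Lemma infprodE (a : nat -> C) N :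
  (forall c, (N <= c)%N -> a c = 1) -> infprod a = \prod_(c < N) a c.
Proof.
move=> a1.
have stab M : (N <= M)%N -> \prod_(c < M) a c = \prod_(c < N) a c.
  move=> leNM; rewrite -!(big_mkord xpredT) (big_cat_nat (n := N)) //=.
  rewrite [X in _ * X]big_nat_cond [X in _ * X]big1 ?mulr1 //.
  by move=> c /andP[/andP[leNc _] _]; apply: a1.
apply: xget_unique => [|p [M stabM]]; first by exists N.
by rewrite -(stabM _ (leq_maxr N M)) stab // leq_maxl.
Qed.

(** If the partial products do not stabilize, [infprod] has the default value 0. So a nonzero term
    constrains every column even before its labels are known to have finite support. *)
Lemma infprod_neq0 (a : nat -> C) : infprod a != 0 -> forall c, a c != 0.
Proof.
rewrite /infprod; case: xgetP => [p _ [N stabN] p0 c|_]; last by rewrite eqxx.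
move: p0; rewrite -(stabN (maxn N c.+1)) ?leq_maxl // => /prodf_neq0.
by move=> /(_ (Ordinal (leq_maxr N c.+1))); apply.
Qed.

Lemma eq_big_support (T : eqType) (r1 r2 : seq T) (G : T -> C) :
  uniq r1 -> uniq r2 ->
  (forall i, G i != 0 -> (i \in r1) = (i \in r2)) ->
  \sum_(i <- r1) G i = \sum_(i <- r2) G i.
Proof.
move=> u1 u2 G12.
rewrite [LHS](bigID (fun i => G i != 0)) [RHS](bigID (fun i => G i != 0)) /=.
rewrite [X in _ + X = _]big1 => [|i /negPn/eqP //].
rewrite [X in _ = _ + X]big1 => [|i /negPn/eqP //].
rewrite !addr0 -[LHS]big_filter -[RHS]big_filter.
apply: perm_big; apply: uniq_perm; rewrite ?filter_uniq // => i.
by rewrite !mem_filter; case: eqVneq => //= Gi; apply: G12.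
Qed.

(** Made for passing from partitions to bit sequences: only [good] sequences encode a partition, the
    others must have weight zero, and only the support of [G] has to be reached. *)
Lemma big_reindex_support (T T' : eqType) (S : seq T) (E : seq T')
    (good : pred T') (g : T' -> T) (G : T -> C) (H : T' -> C) :
  uniq S -> uniq E -> {in [pred e | (e \in E) && good e] &, injective g} ->
  (forall e, e \in E -> good e -> H e = G (g e)) ->
  (forall e, e \in E -> ~~ good e -> H e = 0) ->
  (forall e, e \in E -> good e -> G (g e) != 0 -> g e \in S) ->
  (forall i, i \in S -> G i != 0 -> exists2 e, (e \in E) && good e & i = g e) ->
  \sum_(i <- S) G i = \sum_(e <- E) H e.
Proof.
move=> uS uE g_inj HG H0 gS Sg.
have -> : \sum_(e <- E) H e = \sum_(i <- [seq g e | e <- E & good e]) G i.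
  rewrite big_map big_filter (bigID good) /= [X in _ + X]big1_seq ?addr0.
    rewrite [LHS]big_seq_cond [RHS]big_seq_cond.
    by apply: eq_bigr => e /andP[eE ge]; apply: HG.
  by move=> e /andP[ge eE]; apply: H0.
apply: eq_big_support => // [|i Gi].
  rewrite map_inj_in_uniq ?filter_uniq // => e e'.
  by rewrite !mem_filter => /andP[? ?] /andP[? ?]; apply: g_inj; apply/andP.
apply/idP/mapP => [iS|[e]].
  have [e /andP[eE ge] ->] := Sg i iS Gi.
  by exists e; rewrite // mem_filter ge.
by rewrite mem_filter => /andP[ge eE] defi; rewrite defi gS // -defi.
Qed.

Fixpoint bits N : seq (seq bool) :=
  if N is N'.+1 then [seq b :: e | b <- [:: false; true], e <- bits N']
  else [:: [::]].

Lemma mem_bits N e : (e \in bits N) = (size e == N).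
Proof.
elim: N e => [|N IH] e; first by rewrite inE; case: e.
apply/allpairsP/eqP => [[[b e'] /= [_ e'N ->]]|].
  by move: e'N; rewrite IH => /eqP <-.
case: e => // b e [sz]; exists (b, e); split => //=; first by case: b.
by rewrite IH sz.
Qed.

Lemma bits_uniq N : uniq (bits N).
Proof.
elim: N => // N IH; apply: allpairs_uniq => // -[b e] [b' e'] _ _ /=.
by case=> -> ->.
Qed.

(** Entry [b] of the matrix product T_0 ... T_{N-1} applied to the vector [z]. The edges are
    [b :: e], so column [c] reads its incoming edge in [b :: e] and its outgoing edge in [e]. *)
Definition path_sum (T : nat -> bool -> bool -> C) (z : bool -> C) N b : C :=
  \sum_(e <- bits N)
    (\prod_(c < N) T c (nth false (b :: e) c) (nth false e c))
    * z (nth false (b :: e) N).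

Lemma path_sum0 T z b : path_sum T z 0 b = z b.
Proof. by rewrite /path_sum big_seq1 big_ord0 mul1r. Qed.

Lemma big_bitsS N (F : seq bool -> C) :
  \sum_(e <- bits N.+1) F e =
  \sum_(e <- bits N) F (false :: e) + \sum_(e <- bits N) F (true :: e).
Proof. by rewrite /= cats0 big_cat !big_map. Qed.

Lemma path_sumS T z N b :
  path_sum T z N.+1 b =
  T 0%N b false * path_sum (fun c => T c.+1) z N false +
  T 0%N b true * path_sum (fun c => T c.+1) z N true.
Proof.
rewrite /path_sum big_bitsS !big_distrr /=.
by congr (_ + _); apply: eq_bigr => e _; rewrite big_ord_recl /= mulrA.
Qed.

End Sums.

(** * Partitions, conjugation and finite boxes *)

Section Partitions.
Local Open Scope nat_scope.
Implicit Types (la mu : seq nat) (c d N K : nat).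

Lemma geq_trans : transitive geq.
Proof. by move=> m n p /= nm pm; apply: leq_trans pm nm. Qed.

Lemma part_nthS la c : is_part la -> nth 0 la c.+1 <= nth 0 la c.
Proof.
move=> /andP[srt _]; case: (ltnP c.+1 (size la)) => [lt|ge].
  by apply: (sorted_ltn_nth geq_trans) => //; rewrite ?inE // ltnW.
by rewrite nth_default.
Qed.

Lemma part_nth_anti la c d : is_part la -> c <= d -> nth 0 la d <= nth 0 la c.
Proof.
move=> pla /subnKC <-; elim: (d - c) => [|k IH]; first by rewrite addn0.
by rewrite addnS (leq_trans (part_nthS _ pla)).
Qed.

Lemma part_nth_gt0 la c : is_part la -> (0 < nth 0 la c) = (c < size la).
Proof.
move=> /andP[_ n0]; case: (ltnP c (size la)) => [lt|ge].
  by rewrite lt0n; apply: contraNneq n0 => <-; rewrite mem_nth.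
by rewrite nth_default.
Qed.

Lemma part_size_leq la N : is_part la -> nth 0 la N = 0 -> size la <= N.
Proof. by move=> pla laN; rewrite leqNgt -part_nth_gt0 // laN. Qed.

Lemma part_eq la mu :
  is_part la -> is_part mu -> nth 0 la =1 nth 0 mu -> la = mu.
Proof.
move=> pla pmu e; have sz : size la = size mu.
  apply/eqP; rewrite eqn_leq; apply/andP.
  by split; apply: part_size_leq => //; [rewrite e | rewrite -e];
    rewrite nth_default.
by apply: (eq_from_nth (x0 := 0)) => // c _; apply: e.
Qed.

(** Cutting [f] at its first zero keeps zero parts out, as [is_part] demands. *)
Definition part_of (f : nat -> nat) N : seq nat :=
  mkseq f (find (fun c => f c == 0) (iota 0 N)).

Lemma nonincn_leq (f : nat -> nat) :
  (forall c, f c.+1 <= f c) -> forall c d, c <= d -> f d <= f c.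
Proof.
move=> fS c d /subnKC <-; elim: (d - c) => [|k IH]; first by rewrite addn0.
by rewrite addnS (leq_trans (fS _)).
Qed.

Lemma part_ofP (f : nat -> nat) N :
  (forall c, f c.+1 <= f c) -> f N = 0 ->
  is_part (part_of f N) /\ nth 0 (part_of f N) =1 f.
Proof.
move=> fS fN; rewrite /part_of; set k := find _ _.
have fanti := nonincn_leq fS.
have kN : k <= N by rewrite /k -[X in _ <= X](size_iota 0 N) find_size.
have lt0 c : c < k -> 0 < f c.
  move=> ck; have := before_find 0 ck.
  by rewrite nth_iota ?add0n ?lt0n => [->|]; last exact: leq_trans ck kN.
have fk : f k = 0.
  move: kN; rewrite leq_eqVlt => /orP[/eqP -> //|kN].
  have : has (fun c => f c == 0) (iota 0 N) by rewrite has_find size_iota.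
  by move/(nth_find 0); rewrite -/k nth_iota // => /eqP.
have nthf c : nth 0 (mkseq f k) c = f c.
  case: (ltnP c k) => [ck|kc]; first by rewrite nth_mkseq.
  rewrite nth_default ?size_mkseq //; apply/esym/eqP; rewrite -leqn0 -fk.
  exact: fanti.
split=> //; apply/andP; split.
  rewrite sorted_pairwise; last exact: geq_trans.
  apply/(pairwiseP 0) => i j; rewrite !inE size_mkseq => ik jk ij.
  by rewrite /= !nthf fanti // ltnW.
apply/negP => /(nthP 0)[c]; rewrite size_mkseq => ck.
by rewrite nthf => fc0; have := lt0 c ck; rewrite fc0.
Qed.

(** Both sides say that the cell in row [c] (counted from 0) and column [j] (counted from 1) lies in
    the Young diagram of [la]. *)
Lemma count_geq_part la c j : is_part la -> 0 < j ->
  (c < count (fun p => j <= p) la) = (j <= nth 0 la c).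
Proof.
move=> + j0; elim: la c => [|a la IH] c /= pla.
  by rewrite nth_nil; case: j j0.
have pla' : is_part la.
  rewrite /is_part; move: pla => /andP[/path_sorted -> /=].
  by rewrite inE negb_or => /andP[].
have anti := part_nth_anti pla; case: c => [|c] /=.
  case: (leqP j a) => //= aj; have := IH 0 pla'.
  by have /= := anti 0 1 isT; lia.
case: (leqP j a) => [ja|aj] /=; first by rewrite addnC addn1 ltnS IH.
have := IH c pla'; have := IH c.+1 pla'; have /= := anti 0 c.+1 isT.
have /= := anti 0 c.+2 isT; lia.
Qed.

Lemma count_mem_conj la c : is_part la ->
  count_mem c.+1 (conj_part la) = nth 0 la c - nth 0 la c.+1.
Proof.
move=> pla; rewrite /conj_part count_map.
rewrite (@eq_in_count _ _ (fun j => nth 0 la c.+1 < j <= nth 0 la c)); last first.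
  move=> j; rewrite mem_iota /= => /andP[j0 _].
  have := count_geq_part c pla j0; have := count_geq_part c.+1 pla j0; lia.
have : nth 0 la c <= head 0 la by rewrite -nth0 part_nth_anti.
move: (nth 0 la c) (nth 0 la c.+1) => b a.
have cnt m : count (fun j => a < j <= b) (iota 1 m) = minn b m - a.
  elim: m => [|m IH]; first by rewrite minn0.
  rewrite -[X in iota _ X]addn1 iotaD count_cat IH /= addn0 add1n.
  by case: (ltnP a m.+1); case: (leqP m.+1 b) => //=; lia.
by rewrite cnt => /minn_idPl ->.
Qed.

Fixpoint boxed_seqs N K : seq (seq nat) :=
  if N is N'.+1 then
    [::] :: [seq k :: l | k <- iota 0 K.+1, l <- boxed_seqs N' K]
  else [:: [::]].

Lemma mem_boxed_seqs N K l :
  (l \in boxed_seqs N K) = (size l <= N) && all (fun k => k <= K) l.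
Proof.
elim: N l => [|N IH] [|a l] //.
have -> : (a :: l \in boxed_seqs N.+1 K) =
  (a :: l \in [seq k :: l' | k <- iota 0 K.+1, l' <- boxed_seqs N K]) by [].
rewrite -[size (a :: l)]/(size l).+1 ltnS [all _ _]/=.
apply/allpairsP/idP => [[[k l'] [kK l'B [-> ->]]]|/and3P[lN aK lK]].
  by move: l'B kK; rewrite IH mem_iota add0n ltnS => /andP[/= -> ->] ->.
by exists (a, l); split => //; rewrite ?mem_iota ?IH ?lN ?lK //= ltnS.
Qed.

Definition boxed_parts N K : seq (seq nat) :=
  undup [seq la <- boxed_seqs N K | is_part la].

Lemma boxed_parts_uniq N K : uniq (boxed_parts N K).
Proof. exact: undup_uniq. Qed.

Lemma mem_boxed_parts N K la :
  (la \in boxed_parts N K) = [&& is_part la, size la <= N & nth 0 la 0 <= K].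
Proof.
rewrite mem_undup mem_filter mem_boxed_seqs; case pla: (is_part la) => //=.
congr (_ && _); apply/allP/idP => [lK|l0 k /(nthP 0)[c _ <-]].
  case: la pla lK => [|a la] _ lK; first by rewrite nth_nil.
  by apply: lK; rewrite inE eqxx.
by apply: leq_trans l0; apply: part_nth_anti.
Qed.

End Partitions.

(** * Column weights and their intertwining relation *)

Section TransferMatrix.
Variables (C : fieldType) (q s u x : C).
Hypothesis qq_reg : forall k, 1 - q ^+ k.+1 != 0.
Hypothesis s2_reg : forall k, 1 - s ^+ 2 * q ^+ k != 0.
Hypothesis su_reg : 1 - s * u != 0.

Lemma qpochS a m : qpoch q a m.+1 = qpoch q a m * (1 - a * q ^+ m).
Proof. exact: big_ord_recr. Qed.

Lemma qpoch0 a : qpoch q a 0 = 1.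
Proof. exact: big_ord0. Qed.

Lemma qpoch_qq_neq0 m : qpoch q q m != 0.
Proof.
by rewrite /qpoch prodf_seq_neq0; apply/allP => i _; rewrite -exprS qq_reg.
Qed.

Lemma qpoch_s2_neq0 m : qpoch q (s ^+ 2) m != 0.
Proof. by rewrite /qpoch prodf_seq_neq0; apply/allP => i _; rewrite s2_reg. Qed.

Definition gap_weight g : C := qpoch q (s ^+ 2) g / qpoch q q g.

Lemma gap_weight_neq0 g : gap_weight g != 0.
Proof. by rewrite mulf_neq0 ?invr_eq0 ?qpoch_qq_neq0 ?qpoch_s2_neq0. Qed.

Lemma gap_weightS g :
  gap_weight g.+1 = gap_weight g * (1 - s ^+ 2 * q ^+ g) / (1 - q ^+ g.+1).
Proof.
rewrite /gap_weight !qpochS -exprS; field.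
by rewrite qpoch_qq_neq0 exprS -exprS qq_reg.
Qed.

(** For interlacing partitions the weight W factors into an up weight, a down weight and an inverse
    gap weight. The test [n <= m] encodes interlacing, which truncated subtraction would hide. *)
Definition up_weight (m n : nat) : C :=
  if (n <= m)%N then xqpoch q s x (m - n) / qpoch q q (m - n) else 0.

Definition down_weight (m n : nat) : C :=
  if (n <= m)%N then qpoch q (- (s * x)) (m - n) / qpoch q q (m - n) else 0.

Lemma up_weight_id m : up_weight m m = 1.
Proof. by rewrite /up_weight leqnn subnn qpoch0 /xqpoch big_ord0 divr1. Qed.

Lemma down_weight_id m : down_weight m m = 1.
Proof. by rewrite /down_weight leqnn subnn !qpoch0 divr1. Qed.

(** The common factor [U] replaces the quotient of neighbouring weights, so nothing is divided by x
    + s q^k, which may be zero. *)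
Lemma up_weightS m n : (n <= m)%N ->
  exists2 U, up_weight m n = U * (1 - q ^+ (m - n).+1)
           & up_weight m.+1 n = U * (x + s * q ^+ (m - n)).
Proof.
move=> nm; exists (up_weight m n / (1 - q ^+ (m - n).+1)).
  by rewrite divfK ?qq_reg.
rewrite /up_weight leqW // nm subSn // qpochS.
rewrite /xqpoch big_ord_recr /= -exprS; field.
by rewrite qpoch_qq_neq0 qq_reg.
Qed.

Lemma down_weightS m n : (n < m)%N ->
  exists2 D, down_weight m n.+1 = D * (1 - q ^+ (m - n.+1).+1)
           & down_weight m n = D * (1 + s * x * q ^+ (m - n.+1)).
Proof.
move=> nm; exists (down_weight m n.+1 / (1 - q ^+ (m - n.+1).+1)).
  by rewrite divfK ?qq_reg.
rewrite /down_weight nm ltnW // -subnSK // !qpochS -exprS; field.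
by rewrite qpoch_qq_neq0 qq_reg.
Qed.

(* Conservation of arrows expresses the label of la' by the difference g of
   consecutive parts of mu, and the label of ka' by that of nu. *)
Definition col_weight (g : nat) (e e' : bool) : C :=
  weightw q s u g e (g + e - e') e'.

Definition dual_col_weight (g : nat) (e e' : bool) : C :=
  gap_weight g / gap_weight (g + e' - e) * weightw q s u (g + e' - e) e g e'.

Lemma col_weightE g :
  [/\ col_weight g false false = (1 - s * q ^+ g * u) / (1 - s * u),
      col_weight g.+1 false true = (1 - s ^+ 2 * q ^+ g) * u / (1 - s * u),
      col_weight g true false = (1 - q ^+ g.+1) / (1 - s * u)
    & col_weight g true true = (u - s * q ^+ g) / (1 - s * u)].
Proof.
rewrite /col_weight /weightw !addn0 !subn0 !addn1 !subn1 !succnK.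
by rewrite !eqxx.
Qed.

(** Compared with [col_weightE], the ratio of gap weights exchanges the factors 1 - s^2 q^g and 1 -
    q^(g+1). *)
Lemma dual_col_weightE g :
  [/\ dual_col_weight g false false = (1 - s * q ^+ g * u) / (1 - s * u),
      dual_col_weight g false true = (1 - q ^+ g.+1) * u / (1 - s * u),
      dual_col_weight g.+1 true false = (1 - s ^+ 2 * q ^+ g) / (1 - s * u)
    & dual_col_weight g true true = (u - s * q ^+ g) / (1 - s * u)].
Proof.
rewrite /dual_col_weight /weightw !addn0 !subn0 !addn1 !subn1 !succnK.
rewrite !eqxx !gap_weightS !divff ?gap_weight_neq0 // !mul1r.
by split=> //; field; rewrite ?gap_weight_neq0 ?su_reg ?s2_reg ?qq_reg.
Qed.

(** Up and down weights depend only on differences, so lowering a part of nu amounts to raising the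
    part of mu paired with it. Hence both transfers contain the same up weight, and their down
    weights differ only in reading the outgoing edge here and the incoming edge in
    [dual_transfer]. *)
Definition transfer (mu0 mu1 nu0 nu1 : nat) (e e' : bool) : C :=
  col_weight (mu0 - mu1) e e' * down_weight nu0 (mu1 + e')
  * up_weight (mu1 + e') nu1.

Definition dual_transfer (mu0 mu1 nu0 nu1 : nat) (e e' : bool) : C :=
  dual_col_weight (nu0 - nu1) e e' * down_weight nu0 (mu1 + e)
  * up_weight (mu1 + e') nu1.

(* L and R are the partial sums over the columns from c on, as functions of the
   edge entering column c, with m = mu_c and n = nu_c. The missing cases are
   those where [up_weight] vanishes. *)
Definition intertwined (m n : nat) (L R : bool -> C) : Prop :=
  ((n <= m.+1)%N -> (1 - s * u) * L true =
    (1 - q ^+ (m.+1 - n)) * R false + (u * x + q ^+ (m.+1 - n)) * R true) /\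
  ((n <= m)%N -> (1 - s * u) * L false =
    (1 - s * q ^+ (m - n) * u) * R false + u * (x + s * q ^+ (m - n)) * R true).

(** With M(m - n) the matrix in [intertwined], this amounts to M(mu0 - nu0) * dual transfer =
    transfer * M(mu1 - nu1). Once the order of the parts is fixed, the gaps are sums of nonnegative
    differences, and a rational identity in powers of q remains. *)
Lemma intertwinedS mu0 mu1 nu0 nu1 (L L' R R' : bool -> C) :
  (mu1 <= mu0)%N -> (nu1 <= nu0)%N -> intertwined mu1 nu1 L' R' ->
  (forall e, L e = transfer mu0 mu1 nu0 nu1 e false * L' false +
                   transfer mu0 mu1 nu0 nu1 e true * L' true) ->
  (forall e, R e = dual_transfer mu0 mu1 nu0 nu1 e false * R' false +
                   dual_transfer mu0 mu1 nu0 nu1 e true * R' true) ->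
  intertwined mu0 nu0 L R.
Proof.
move=> le_mu le_nu [inv1 inv0] LE RE; rewrite /intertwined !LE !RE.
rewrite /transfer /dual_transfer !addn0 !addn1.
have [wl00 _ wl10 wl11] := col_weightE (mu0 - mu1).
have [wr00 wr01 _ wr11] := dual_col_weightE (nu0 - nu1).
case: (ltngtP nu0 mu1) => [lt|gt|eq].
- have dn0 : down_weight nu0 mu1 = 0 by rewrite /down_weight leqNgt lt.
  have dn1 : down_weight nu0 mu1.+1 = 0 by rewrite /down_weight leqNgt ltnW.
  by rewrite dn0 dn1 !(mulr0, mul0r, addr0).
- set k := (nu0 - mu1.+1)%N.
  (* These two weights are stated at a successor gap, hence the predecessors; they are rewritten
     only after the gap has been shown to be positive. *)
  have [_ wl01 _ _] := col_weightE (mu0 - mu1).-1.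
  have [_ _ wr10 _] := dual_col_weightE (nu0 - nu1).-1.
  have [nu1_le|mu1_lt] := leqP nu1 mu1; last first.
    have up0 : up_weight mu1 nu1 = 0 by rewrite /up_weight leqNgt mu1_lt.
    have [def_nu1|ne] := eqVneq nu1 mu1.+1; last first.
      have lt1 : (mu1.+1 < nu1)%N by lia.
      have up1 : up_weight mu1.+1 nu1 = 0 by rewrite /up_weight leqNgt lt1.
      by rewrite up0 up1 !(mulr0, mul0r, addr0).
    (* Here nu1 = mu1 + 1, so only the edge [true] survives; the coefficient 1 - q^0 of [R' false]
       vanishes, which closes the relation on that edge. *)
    have inv1' : (1 - s * u) * L' true = (u * x + 1) * R' true.
      by rewrite inv1 def_nu1 // subnn expr0 subrr mul0r add0r.
    have -> : L' true = (u * x + 1) * R' true / (1 - s * u).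
      by rewrite -inv1'; field.
    have [D -> ->] := down_weightS gt; rewrite up0 def_nu1 up_weight_id -/k.
    rewrite def_nu1 -/k in wr01 wr11; rewrite wr01 wr11.
    split=> le.
      have def_g : (mu0 - mu1 = mu0.+1 - nu0 + k)%N by rewrite /k; lia.
      by rewrite wl11 def_g !exprS !exprD; field.
    have def_g : (mu0 - mu1 = (mu0 - nu0 + k).+1)%N by rewrite /k; lia.
    rewrite def_g in wl01 *; rewrite wl01 /=.
    by rewrite !exprS !exprD; field.
  have := inv1 (leqW nu1_le); have := inv0 nu1_le; rewrite subSn //.
  have [U -> ->] := up_weightS nu1_le; have [D -> ->] := down_weightS gt.
  rewrite -/k.
  have def_g' : (nu0 - nu1 = (k + (mu1 - nu1)).+1)%N by rewrite /k; lia.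
  rewrite def_g' in wr00 wr01 wr10 wr11 *; rewrite wr00 wr01 wr10 wr11 /=.
  move: (mu1 - nu1)%N => j inv0' inv1'.
  have -> : L' false = ((1 - s * q ^+ j * u) * R' false +
      u * (x + s * q ^+ j) * R' true) / (1 - s * u).
    by rewrite -inv0'; field.
  have -> : L' true = ((1 - q ^+ j.+1) * R' false +
      (u * x + q ^+ j.+1) * R' true) / (1 - s * u).
    by rewrite -inv1'; field.
  split=> le.
    have def_g : (mu0 - mu1 = mu0.+1 - nu0 + k)%N by rewrite /k; lia.
    by rewrite wl10 wl11 def_g !exprS !exprD; field.
  have def_g : (mu0 - mu1 = (mu0 - nu0 + k).+1)%N by rewrite /k; lia.
  rewrite def_g in wl00 wl01 *; rewrite wl00 wl01 /=.
  by rewrite !exprS !exprD; field.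
(* With nu0 = mu1 the outgoing edge [true] on the left and the incoming edge [true] on the right
   have weight zero, so only the relation for [L' false] enters. *)
- have le1 : (nu1 <= mu1)%N by rewrite -eq.
  rewrite eq in wr00 wr01 *; have := inv0 le1.
  rewrite wr00 wr01 wl00 wl10 down_weight_id.
  have -> : down_weight mu1 mu1.+1 = 0 by rewrite /down_weight ltnn.
  have [U -> ->] := up_weightS le1; rewrite subSn //.
  move: (mu0 - mu1)%N (mu1 - nu1)%N => a j invj.
  have -> : L' false = ((1 - s * q ^+ j * u) * R' false +
      u * (x + s * q ^+ j) * R' true) / (1 - s * u).
    by rewrite -invj; field.
  by split=> _; rewrite ?exprS; field.
Qed.

Definition path_up (mu nu : nat -> nat) :=
  path_sum (fun c => transfer (mu c) (mu c.+1) (nu c) (nu c.+1))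
    (fun e => col_weight 0 e false).

Definition path_down (mu nu : nat -> nat) :=
  path_sum (fun c => dual_transfer (mu c) (mu c.+1) (nu c) (nu c.+1))
    (fun e => dual_col_weight 0 e false).

Lemma path_intertwined (mu nu : nat -> nat) N :
  (forall c, (mu c.+1 <= mu c)%N) -> (forall c, (nu c.+1 <= nu c)%N) ->
  mu N = 0%N -> nu N = 0%N ->
  intertwined (mu 0%N) (nu 0%N) (path_up mu nu N) (path_down mu nu N).
Proof.
elim: N mu nu => [|N IH] mu nu muS nuS muN nuN; last first.
  have IH' := IH (mu \o S) (nu \o S) (fun c => muS c.+1) (fun c => nuS c.+1)
    muN nuN.
  by apply: (intertwinedS (muS 0%N) (nuS 0%N) IH') => e; apply: path_sumS.
rewrite muN nuN /path_up /path_down.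
have [wl00 _ wl10 _] := col_weightE 0; have [wr00 _ _ _] := dual_col_weightE 0.
split=> _; rewrite !path_sum0 ?wl00 ?wl10 wr00.
(* A zero part of nu cannot be lowered, whereas a zero part of mu can be raised: only the right-hand
   boundary weight vanishes. *)
all: rewrite (_ : dual_col_weight 0 true false = 0); last first.
all: try by rewrite /dual_col_weight /weightw mulr0.
all: by rewrite ?subn0 ?expr1 ?expr0; field.
Qed.

(* The row vector (1, u) is an eigenvector of the intertwining matrix. *)
Lemma intertwined_edge m n (L R : bool -> C) : intertwined m n L R ->
  up_weight m n * L false + u * up_weight m.+1 n * L true =
  (1 + u * x) / (1 - s * u) *
    (up_weight m n * R false + u * up_weight m.+1 n * R true).
Proof.
move=> [inv1 inv0]; apply: (mulfI su_reg).
rewrite [RHS]mulrA [(1 - s * u) * (_ / _)]mulrC divfK //.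
have [nm|mn] := leqP n m.
  have [U -> ->] := up_weightS nm.
  transitivity (U * (1 - q ^+ (m - n).+1) * ((1 - s * u) * L false) +
      u * (U * (x + s * q ^+ (m - n))) * ((1 - s * u) * L true)); first by ring.
  by rewrite inv0 // inv1 ?leqW // subSn // !exprS; ring.
have -> : up_weight m n = 0 by rewrite /up_weight leqNgt mn.
have [def_n|ne] := eqVneq n m.+1; last first.
  rewrite /up_weight ifF; last by lia.
  by rewrite !(mulr0, mul0r, addr0).
move: inv1; rewrite def_n up_weight_id leqnn subnn => /(_ isT) inv1.
transitivity (u * ((1 - s * u) * L true)); first by ring.
by rewrite inv1; ring.
Qed.

End TransferMatrix.

(** * One-variable skew functions as products over columns *)

Section Skew.
Variables (C : fieldType) (q s u : C).
Hypothesis qq_reg : forall k, 1 - q ^+ k.+1 != 0.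
Hypothesis s2_reg : forall k, 1 - s ^+ 2 * q ^+ k != 0.
Implicit Types (x : C) (la mu nu ka : seq nat).

Notation gap la c := (nth 0%N la c - nth 0%N la c.+1)%N.
Notation gapw := (gap_weight q s).

Lemma up_weight_add x m n k : up_weight q s x (m + k) (n + k) = up_weight q s x m n.
Proof. by rewrite /up_weight leq_add2r subnDr. Qed.

Lemma down_weight_add x m n k :
  down_weight q s x (m + k) (n + k) = down_weight q s x m n.
Proof. by rewrite /down_weight leq_add2r subnDr. Qed.

Lemma gap_weight0 : gapw 0 = 1.
Proof. by rewrite /gap_weight !qpoch0 divr1. Qed.

Lemma nth_geq_size la N c : (size la <= N)%N -> (N <= c)%N -> nth 0%N la c = 0%N.
Proof. by move=> laN Nc; rewrite nth_default // (leq_trans laN). Qed.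

(** The skew function F_{la/ka}(x) in one variable; [qW_row_skew] identifies it with one row of the
    lattice sum. *)
Definition skew_qW x la ka : C :=
  infprod (fun c => up_weight q s x (nth 0%N la c) (nth 0%N ka c) *
    down_weight q s x (nth 0%N ka c) (nth 0%N la c.+1) / gapw (gap la c)).

Lemma skew_qWE x la ka N : (size la <= N)%N -> (size ka <= N)%N ->
  skew_qW x la ka =
  \prod_(c < N) (up_weight q s x (nth 0%N la c) (nth 0%N ka c) *
    down_weight q s x (nth 0%N ka c) (nth 0%N la c.+1) / gapw (gap la c)).
Proof.
move=> laN kaN; apply: infprodE => c Nc.
rewrite !(nth_geq_size laN) ?(nth_geq_size kaN) ?leqW //.
by rewrite up_weight_id down_weight_id subnn gap_weight0 divr1 mulr1.
Qed.

Lemma skew_qW_interlace x la ka c : skew_qW x la ka != 0 ->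
  (nth 0 la c.+1 <= nth 0 ka c <= nth 0 la c)%N.
Proof.
move=> /infprod_neq0/(_ c); rewrite /up_weight /down_weight.
by do 2 case: ifP => //; rewrite ?(mulr0, mul0r, eqxx).
Qed.

Lemma ctilde_conj la N : is_part la -> (size la <= N)%N ->
  ctilde q s (conj_part la) = \prod_(c < N) gapw (gap la c).
Proof.
move=> pla laN; rewrite /ctilde.
under [in LHS]eq_fun do rewrite count_mem_conj //.
apply: infprodE => c Nc.
by rewrite -/(gapw (gap la c)) !(nth_geq_size laN) ?leqW // gap_weight0.
Qed.

Lemma ctilde_conj_neq0 la : is_part la -> ctilde q s (conj_part la) != 0.
Proof.
move=> pla; rewrite (ctilde_conj pla (leqnn _)) prodf_seq_neq0.
by apply/allP => c _; rewrite gap_weight_neq0.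
Qed.

Notation hstep la mu c := (nth 0%N la c != nth 0%N mu c).

Lemma weightw_neq0 i j k l : weightw q s u i j k l != 0 -> (i + j = k + l)%N.
Proof. by rewrite /weightw; case: (eqVneq (i + j)%N) => // _; rewrite eqxx. Qed.

(** Conservation telescopes from the far columns, where [h] and all parts vanish; hence the
    induction on the distance to a common bound. *)
Lemma spinHL_path la mu (h : nat -> bool) : is_part la -> is_part mu ->
  eventually0 h ->
  (forall c, (gap mu c + h c = gap la c + h c.+1)%N) ->
  forall c, nth 0%N la c = (nth 0%N mu c + h c)%N.
Proof.
move=> pla pmu [M h0] cons c.
have [k] := ubnP (maxn M (maxn (size la) (size mu)) - c)%N.
elim: k c => // k IH c; rewrite ltnS => lek.
have [le|lt] := leqP (maxn M (maxn (size la) (size mu))) c.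
  by move: le; rewrite !geq_max => /and3P[? ? ?]; rewrite h0 // !nth_default.
have := IH c.+1 ltac:(lia); have := cons c.
have := part_nthS c pla; have := part_nthS c pmu; lia.
Qed.

Lemma spinHL_conj_strip la mu : is_part la -> is_part mu ->
  spinHL q s u (conj_part la) (conj_part mu) != 0 ->
  forall c, nth 0%N la c = (nth 0%N mu c + hstep la mu c)%N.
Proof.
move=> pla pmu /eqP; rewrite /spinHL => ne c; apply: contrapT => nstrip.
apply: ne; apply: fsbig1 => h h_ev; apply/eqP; apply: contrapT => /negP.
rewrite mulf_eq0 negb_or => /andP[_ /infprod_neq0 w0]; apply: nstrip.
have cons d : (gap mu d + h d = gap la d + h d.+1)%N.
  by rewrite -!count_mem_conj //; apply: weightw_neq0 (w0 d).
by have := spinHL_path pla pmu h_ev cons c; case: (h c); lia.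
Qed.

Hypothesis su_reg : 1 - s * u != 0.

Lemma spinHL_conj la mu N :
  is_part la -> is_part mu -> (size la <= N)%N -> (size mu <= N)%N ->
  spinHL q s u (conj_part la) (conj_part mu) =
  u ^+ hstep la mu 0 * \prod_(c < N)
    weightw q s u (gap mu c) (hstep la mu c) (gap la c) (hstep la mu c.+1).
Proof.
move=> pla pmu laN muN; set h0 := fun c => hstep la mu c.
have h0_ev : eventually0 h0.
  by exists N => c Nc; rewrite /h0 (nth_geq_size laN) // (nth_geq_size muN).
rewrite /spinHL (fsbigE [:: h0]) //=; last 2 first.
- by move=> h; rewrite /= inE => /eqP ->.
- move=> h h_ev; apply: contraNeq; rewrite mulf_eq0 negb_or => /andP[_ w0].
  rewrite inE; apply/eqP/funext => c; rewrite /h0.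
  have cons d : (gap mu d + h d = gap la d + h d.+1)%N.
    by rewrite -!count_mem_conj //; apply: weightw_neq0 (infprod_neq0 w0 d).
  by have := spinHL_path pla pmu h_ev cons c; case: (h c); lia.
rewrite big_cons big_nil ifT ?addr0; last exact: mem_set h0_ev.
congr (_ * _).
under [in LHS]eq_fun do rewrite !count_mem_conj //.
apply: infprodE => c Nc.
rewrite /h0 !(nth_geq_size laN) ?(nth_geq_size muN) ?leqW //.
by rewrite subnn eqxx /weightw expr0 mulr1 divff.
Qed.

Lemma skew_dual_prod x la mu nu N :
  is_part la -> is_part mu -> (size la <= N)%N -> (size mu <= N)%N ->
  (size nu <= N)%N ->
  skew_qW x la nu * spinHL_dual q s u (conj_part la) (conj_part mu) =
  (ctilde q s (conj_part mu))^-1 * (u ^+ hstep la mu 0 *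
   \prod_(c < N) (up_weight q s x (nth 0%N la c) (nth 0%N nu c) *
     (down_weight q s x (nth 0%N nu c) (nth 0%N la c.+1) *
      weightw q s u (gap mu c) (hstep la mu c) (gap la c) (hstep la mu c.+1)))).
Proof.
move=> pla pmu laN muN nuN.
have G0 := ctilde_conj_neq0 pla; have M0 := ctilde_conj_neq0 pmu.
rewrite /spinHL_dual (skew_qWE x laN nuN) (spinHL_conj pla pmu laN muN).
rewrite big_split prodfV -(ctilde_conj pla laN) !big_split /=; field.
by rewrite G0 M0.
Qed.

Lemma skew_dual_prod' x mu nu ka N :
  is_part mu -> is_part nu -> is_part ka ->
  (size mu <= N)%N -> (size nu <= N)%N -> (size ka <= N)%N ->
  skew_qW x mu ka * spinHL_dual q s u (conj_part nu) (conj_part ka) =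
  (ctilde q s (conj_part mu))^-1 * (u ^+ hstep nu ka 0 *
   \prod_(c < N) (up_weight q s x (nth 0%N mu c) (nth 0%N ka c) *
     (down_weight q s x (nth 0%N ka c) (nth 0%N mu c.+1) *
      (gapw (gap nu c) / gapw (gap ka c) *
       weightw q s u (gap ka c) (hstep nu ka c) (gap nu c) (hstep nu ka c.+1))))).
Proof.
move=> pmu pnu pka muN nuN kaN.
have K0 := ctilde_conj_neq0 pka; have M0 := ctilde_conj_neq0 pmu.
rewrite /spinHL_dual (skew_qWE x muN kaN) (spinHL_conj pnu pka nuN kaN).
rewrite big_split prodfV -(ctilde_conj pmu muN) [in LHS]big_split /=.
set P := \prod_(i < N) up_weight _ _ _ _ _.
set Q := \prod_(i < N) down_weight _ _ _ _ _.
set W := \prod_(i < N) weightw _ _ _ _ _ _ _.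
rewrite [in RHS](_ : \prod_(c < N) _ =
    P * (Q * (ctilde q s (conj_part nu) / ctilde q s (conj_part ka) * W))).
  by field; rewrite K0 M0.
by rewrite (ctilde_conj pnu nuN) (ctilde_conj pka kaN) -prodfV -!big_split.
Qed.

(** The weight W of a column contains the up weight of the next column, whence the shift. The
    remaining [A 0] is the boundary weight at the edge h_0. *)
Lemma prod_shift (A B : nat -> C) N :
  \prod_(c < N.+1) (A c * B c) = A 0%N * (\prod_(c < N) (B c * A c.+1) * B N).
Proof.
by rewrite !big_split /= [X in X * _]big_ord_recl [X in _ * X]big_ord_recr /=; ring.
Qed.

End Skew.

(** * The commutation relation for one variable *)

Section Commutation.
Variables (C : fieldType) (q s u x : C).
Hypothesis qq_reg : forall k, 1 - q ^+ k.+1 != 0.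
Hypothesis s2_reg : forall k, 1 - s ^+ 2 * q ^+ k != 0.
Hypothesis su_reg : 1 - s * u != 0.
Variables (mu nu : seq nat) (N : nat).
Hypotheses (pmu : is_part mu) (pnu : is_part nu).
Hypotheses (muN : (size mu <= N)%N) (nuN : (size nu <= N)%N).
Variable S : seq (seq nat).
Hypotheses (S_uniq : uniq S) (S_part : forall la, la \in S -> is_part la).

Notation dual la ka := (spinHL_dual q s u (conj_part la) (conj_part ka)).

Lemma sum_skew_dual_up :
  (forall la, is_part la -> skew_qW q s x la nu * dual la mu != 0 -> la \in S) ->
  \sum_(la <- S) skew_qW q s x la nu * dual la mu =
  (ctilde q s (conj_part mu))^-1 *
  (up_weight q s x (nth 0%N mu 0) (nth 0%N nu 0) *
     path_up q s u x (nth 0%N mu) (nth 0%N nu) N false +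
   u * up_weight q s x (nth 0%N mu 0).+1 (nth 0%N nu 0) *
     path_up q s u x (nth 0%N mu) (nth 0%N nu) N true).
Proof.
move=> S_supp; pose f (e : seq bool) c := (nth 0 mu c + nth false e c)%N.
pose H e := (ctilde q s (conj_part mu))^-1 * (u ^+ nth false e 0%N *
  (up_weight q s x (f e 0%N) (nth 0%N nu 0) *
  (\prod_(c < N) transfer q s u x (nth 0%N mu c) (nth 0%N mu c.+1) (nth 0%N nu c)
     (nth 0%N nu c.+1) (nth false e c) (nth false e c.+1) *
   col_weight q s u 0 (nth false e N) false))).
have -> : \sum_(la <- S) skew_qW q s x la nu * dual la mu =
    \sum_(e <- bits N.+1) H e; last first.
  (* The first bit is the edge h_0; splitting on it gives the two path sums with weights 1 and u. *)
  rewrite big_bitsS mulrDr /path_up /path_sum !big_distrr /=.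
  congr (_ + _); apply: eq_bigr => e _; rewrite /H /f /=.
    by rewrite expr0 mul1r addn0.
  by rewrite expr1 addn1 mulrA.
(* The condition that mu + e is again a partition. It may have N + 1 parts, hence N + 1 bits. *)
pose good e := all (fun c => f e c.+1 <= f e c)%N (iota 0 N).
pose g e := part_of (f e) N.+1.
have muS c := part_nthS c pmu.
have gP e : e \in bits N.+1 -> good e ->
    is_part (g e) /\ nth 0%N (g e) =1 f e.
  rewrite mem_bits => /eqP sz /allP ge; apply: part_ofP => [c|]; last first.
    by rewrite /f (nth_geq_size muN) // nth_default ?sz ?leqnn.
  case: (ltnP c N) => [cN|Nc]; first by apply: ge; rewrite mem_iota.
  by rewrite /f (nth_geq_size muN (leqW Nc)) [nth false _ _.+1]nth_default ?sz.
apply: (@big_reindex_support C _ _ S (bits N.+1) good g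
  (fun la => skew_qW q s x la nu * dual la mu) H) => //.
- exact: bits_uniq.
- move=> e e' /andP[eE ge] /andP[eE' ge'] gee'.
  have [_ ne] := gP e eE ge; have [_ ne'] := gP e' eE' ge'.
  move: eE eE'; rewrite !mem_bits => /eqP sz /eqP sz'.
  apply: (eq_from_nth (x0 := false)) => [|c _]; first by rewrite sz sz'.
  have := ne c; rewrite gee' ne' /f => /addnI.
  by do 2 case: nth.
- move=> e eE ge; have [pg ng] := gP e eE ge.
  have gN : (size (g e) <= N.+1)%N.
    apply: part_size_leq => //; rewrite ng /f (nth_geq_size muN) // nth_default //.
    by move: eE; rewrite mem_bits => /eqP ->.
  rewrite (skew_dual_prod qq_reg s2_reg su_reg x pg pmu gN _ (leqW nuN)) ?leqW //.
  have hE c : (nth 0%N (g e) c != nth 0%N mu c) = nth false e c.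
    by rewrite ng /f; case: nth; lia.
  rewrite hE /H; congr (_ * (_ * _)).
  have wE c : weightw q s u (nth 0%N mu c - nth 0%N mu c.+1)
      (nth 0%N (g e) c != nth 0%N mu c) (nth 0%N (g e) c - nth 0%N (g e) c.+1)
      (nth 0%N (g e) c.+1 != nth 0%N mu c.+1) =
    col_weight q s u (nth 0%N mu c - nth 0%N mu c.+1) (nth false e c)
      (nth false e c.+1).
    rewrite !hE /col_weight; congr weightw; have := part_nthS c pg.
    by have := muS c; rewrite !ng /f; lia.
  rewrite (prod_shift (fun c => up_weight q s x (nth 0%N (g e) c) (nth 0%N nu c))
    (fun c => down_weight q s x (nth 0%N nu c) (nth 0%N (g e) c.+1) *
      weightw q s u (nth 0%N mu c - nth 0%N mu c.+1)
      (nth 0%N (g e) c != nth 0%N mu c) (nth 0%N (g e) c - nth 0%N (g e) c.+1)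
      (nth 0%N (g e) c.+1 != nth 0%N mu c.+1))).
  rewrite ng; congr (_ * (_ * _)).
    apply: eq_bigr => c _; rewrite wE !ng /transfer /f; ring.
  rewrite wE !ng /f !(nth_geq_size muN) ?(nth_geq_size nuN) ?leqW //.
  rewrite [nth false e N.+1]nth_default ?addn0 ?down_weight_id ?mul1r //.
  by move: eE; rewrite mem_bits => /eqP ->.
(* Monotonicity fails only if mu has equal parts at c and c + 1 and just the second one is raised;
   then conservation fails in column c. *)
- move=> e eE /allPn[c]; rewrite mem_iota /= add0n -ltnNge => cN bad.
  rewrite /H (bigD1 (Ordinal cN)) //= /transfer.
  have -> : col_weight q s u (nth 0%N mu c - nth 0%N mu c.+1) (nth false e c)
      (nth false e c.+1) = 0.
    have := muS c; move: bad; rewrite /f /col_weight /weightw.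
    case: (nth false e c); case: (nth false e c.+1) => /=; try lia.
    by move=> ? ?; rewrite ifF //; lia.
  by rewrite !(mul0r, mulr0).
- by move=> e eE ge; apply: S_supp; have [] := gP e eE ge.
- move=> la /S_part pla; rewrite mulf_eq0 negb_or => /andP[sk du].
  have strip : forall c,
      nth 0%N la c = (nth 0%N mu c + (nth 0%N la c != nth 0%N mu c))%N.
    apply: (@spinHL_conj_strip _ q s u) => //.
    by apply: contraNneq du; rewrite /spinHL_dual => ->; rewrite mulr0.
  have laN : (size la <= N.+1)%N.
    apply: part_size_leq => //; have := skew_qW_interlace N sk.
    by rewrite (nth_geq_size nuN) //; lia.
  pose e := mkseq (fun c => nth 0%N la c != nth 0%N mu c) N.+1.
  have ne c : f e c = nth 0%N la c.
    rewrite /f; case: (ltnP c N.+1) => cN; first by rewrite nth_mkseq -?strip.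
    by rewrite [nth false _ _]nth_default ?size_mkseq // (nth_geq_size laN) //
      (nth_geq_size muN) // ltnW.
  have eE : e \in bits N.+1 by rewrite mem_bits size_mkseq.
  have ge : good e by apply/allP => c _; rewrite !ne part_nthS.
  exists e; first exact/andP.
  by have [pg ng] := gP e eE ge; apply: part_eq => // c; rewrite ng ne.
Qed.

Lemma sum_skew_dual_down :
  (forall ka, is_part ka -> skew_qW q s x mu ka * dual nu ka != 0 -> ka \in S) ->
  \sum_(ka <- S) skew_qW q s x mu ka * dual nu ka =
  (ctilde q s (conj_part mu))^-1 *
  (up_weight q s x (nth 0%N mu 0) (nth 0%N nu 0) *
     path_down q s u x (nth 0%N mu) (nth 0%N nu) N false +
   u * up_weight q s x (nth 0%N mu 0).+1 (nth 0%N nu 0) *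
     path_down q s u x (nth 0%N mu) (nth 0%N nu) N true).
Proof.
move=> S_supp; pose f (e : seq bool) c := (nth 0 nu c - nth false e c)%N.
pose H e := (ctilde q s (conj_part mu))^-1 * (u ^+ nth false e 0%N *
  (up_weight q s x (nth 0 mu 0 + nth false e 0)%N (nth 0%N nu 0) *
  (\prod_(c < N) dual_transfer q s u x (nth 0%N mu c) (nth 0%N mu c.+1)
     (nth 0%N nu c) (nth 0%N nu c.+1) (nth false e c) (nth false e c.+1) *
   dual_col_weight q s u 0 (nth false e N) false))).
have -> : \sum_(ka <- S) skew_qW q s x mu ka * dual nu ka =
    \sum_(e <- bits N.+1) H e; last first.
  rewrite big_bitsS mulrDr /path_down /path_sum !big_distrr /=.
  congr (_ + _); apply: eq_bigr => e _; rewrite /H /=.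
    by rewrite expr0 mul1r addn0.
  by rewrite expr1 addn1 mulrA.
(* Written with additions only, since truncated subtraction would mask the lowering of a zero part;
   part N of nu is zero, so its bit must be [false]. *)
pose good e := all (fun c => nth 0 nu c.+1 + nth false e c
    <= nth 0 nu c + nth false e c.+1)%N (iota 0 N) && ~~ nth false e N.
pose g e := part_of (f e) N.
have nuS c := part_nthS c pnu.
(* Goodness propagates e_c <= nu_c downwards from column N, so nu - e involves no truncation. *)
have e_le e c : e \in bits N.+1 -> good e -> (nth false e c <= nth 0 nu c)%N.
  rewrite mem_bits => /eqP sz /andP[/allP ge /negbTE eN].
  have [k] := ubnP (N - c)%N; elim: k c => // k IH c; rewrite ltnS => lek.
  case: (ltngtP c N) => [cN|Nc|->]; last by rewrite eN.
    have := ge c; rewrite mem_iota add0n cN => /(_ isT).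
    by have := IH c.+1 ltac:(lia); have := nuS c; lia.
  by rewrite nth_default // sz.
have gP e : e \in bits N.+1 -> good e ->
    is_part (g e) /\ nth 0%N (g e) =1 f e.
  move=> eE ge; apply: part_ofP => [c|]; last first.
    by rewrite /f (nth_geq_size nuN).
  have lec := e_le e c eE ge; have := e_le e c.+1 eE ge.
  case: (ltnP c N) => [cN|Nc].
    move: ge => /andP[/allP/(_ c) + _]; rewrite mem_iota add0n cN => /(_ isT).
    by rewrite /f; lia.
  by rewrite /f (nth_geq_size nuN (leqW Nc)).
have fE e c : e \in bits N.+1 -> good e -> (f e c + nth false e c = nth 0 nu c)%N.
  by move=> eE ge; rewrite /f subnK // e_le.
apply: (@big_reindex_support C _ _ S (bits N.+1) good g
  (fun ka => skew_qW q s x mu ka * dual nu ka) H) => //.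
- exact: bits_uniq.
- move=> e e' /andP[eE ge] /andP[eE' ge'] gee'.
  have [_ ne] := gP e eE ge; have [_ ne'] := gP e' eE' ge'.
  have fE1 c := fE e c eE ge; have fE2 c := fE e' c eE' ge'.
  move: eE eE'; rewrite !mem_bits => /eqP sz /eqP sz'.
  apply: (eq_from_nth (x0 := false)) => [|c _]; first by rewrite sz sz'.
  have := ne c; rewrite gee' ne'; have := fE1 c; have := fE2 c.
  by do 2 case: nth => //=; lia.
- move=> e eE ge; have [pg ng] := gP e eE ge; have fEe c := fE e c eE ge.
  have gN : (size (g e) <= N.+1)%N.
    by apply: part_size_leq; rewrite // ng /f (nth_geq_size nuN).
  rewrite (skew_dual_prod' qq_reg s2_reg su_reg x pmu pnu pg _ _ gN) ?leqW //.
  have hE c : (nth 0%N nu c != nth 0%N (g e) c) = nth false e c.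
    by rewrite ng -fEe; case: nth; lia.
  rewrite hE /H; congr (_ * (_ * _)).
  have upE c : up_weight q s x (nth 0%N mu c) (nth 0%N (g e) c) =
      up_weight q s x (nth 0 mu c + nth false e c)%N (nth 0%N nu c).
    by rewrite ng -fEe up_weight_add.
  have downE c : down_weight q s x (nth 0%N (g e) c) (nth 0%N mu c.+1) =
      down_weight q s x (nth 0%N nu c) (nth 0 mu c.+1 + nth false e c)%N.
    by rewrite ng -fEe down_weight_add.
  pose W c := gap_weight q s (nth 0%N nu c - nth 0%N nu c.+1) /
      gap_weight q s (nth 0%N (g e) c - nth 0%N (g e) c.+1) *
    weightw q s u (nth 0%N (g e) c - nth 0%N (g e) c.+1)
      (nth 0%N nu c != nth 0%N (g e) c) (nth 0%N nu c - nth 0%N nu c.+1)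
      (nth 0%N nu c.+1 != nth 0%N (g e) c.+1).
  have wE c : W c = dual_col_weight q s u (nth 0%N nu c - nth 0%N nu c.+1)
      (nth false e c) (nth false e c.+1).
    rewrite /W !hE /dual_col_weight.
    have -> // : (nth 0 (g e) c - nth 0 (g e) c.+1 =
      nth 0 nu c - nth 0 nu c.+1 + nth false e c.+1 - nth false e c)%N.
    have := part_nthS c pg; have := nuS c; have := fEe c; have := fEe c.+1.
    by rewrite !ng; lia.
  rewrite (prod_shift (fun c => up_weight q s x (nth 0%N mu c) (nth 0%N (g e) c))
    (fun c => down_weight q s x (nth 0%N (g e) c) (nth 0%N mu c.+1) * W c)).
  rewrite upE; congr (_ * (_ * _)).
    by apply: eq_bigr => c _; rewrite wE upE downE /dual_transfer; ring.
  rewrite wE downE; move: ge => /andP[_ /negbTE eN]; rewrite eN.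
  rewrite !(nth_geq_size nuN) ?(nth_geq_size muN) ?leqW //.
  rewrite [nth false e N.+1]nth_default ?addn0 ?down_weight_id ?mul1r //.
  by move: eE; rewrite mem_bits => /eqP ->.
- move=> e eE; rewrite negb_and negbK => /orP[/allPn[c]|eN]; last first.
    rewrite /H eN (_ : dual_col_weight _ _ _ _ _ _ = 0) ?mulr0 //.
    by rewrite /dual_col_weight /weightw mulr0.
  rewrite mem_iota /= add0n -ltnNge => cN bad.
  rewrite /H (bigD1 (Ordinal cN)) //= /dual_transfer.
  have -> : dual_col_weight q s u (nth 0%N nu c - nth 0%N nu c.+1) (nth false e c)
      (nth false e c.+1) = 0.
    have := nuS c; move: bad; rewrite /dual_col_weight /weightw.
    case: (nth false e c); case: (nth false e c.+1) => /=; try lia.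
    by move=> ? ?; rewrite ifF ?mulr0 //; lia.
  by rewrite !(mul0r, mulr0).
- by move=> e eE ge; apply: S_supp; have [] := gP e eE ge.
- move=> ka /S_part pka; rewrite mulf_eq0 negb_or => /andP[sk du].
  have strip : forall c,
      nth 0%N nu c = (nth 0%N ka c + (nth 0%N nu c != nth 0%N ka c))%N.
    apply: (@spinHL_conj_strip _ q s u) => //.
    by apply: contraNneq du; rewrite /spinHL_dual => ->; rewrite mulr0.
  have kaN c : (N <= c)%N -> nth 0%N ka c = 0%N.
    by move=> Nc; have := strip c; rewrite (nth_geq_size nuN) //; lia.
  pose e := mkseq (fun c => nth 0%N nu c != nth 0%N ka c) N.+1.
  have eE : e \in bits N.+1 by rewrite mem_bits size_mkseq.
  have ne c : (nth 0 ka c + nth false e c = nth 0 nu c)%N.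
    case: (ltnP c N.+1) => cN; first by rewrite nth_mkseq -?strip.
    by rewrite [nth false _ _]nth_default ?size_mkseq // kaN
      ?(nth_geq_size nuN) // ltnW.
  have ge : good e.
    apply/andP; split.
      apply/allP => c _; have := ne c; have := ne c.+1; have := part_nthS c pka.
      by lia.
    by rewrite nth_mkseq // kaN // (nth_geq_size nuN).
  exists e; first exact/andP.
  have [pg ng] := gP e eE ge; apply: part_eq => // c; rewrite ng.
  by rewrite /f -ne addnK.
Qed.

(** Both sums pair the same row vector, (up(mu_0, nu_0), u up(mu_0 + 1, nu_0)), with their path
    sums, and [intertwined_edge] supplies the scalar. *)
Lemma skew_commutation :
  (forall la, is_part la -> skew_qW q s x la nu * dual la mu != 0 -> la \in S) ->
  (forall ka, is_part ka -> skew_qW q s x mu ka * dual nu ka != 0 -> ka \in S) ->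
  \sum_(la <- S) skew_qW q s x la nu * dual la mu =
  (1 + u * x) / (1 - s * u) * \sum_(ka <- S) skew_qW q s x mu ka * dual nu ka.
Proof.
move=> S1 S2; rewrite sum_skew_dual_up // sum_skew_dual_down // mulrCA.
congr (_ * _); apply: (intertwined_edge qq_reg su_reg).
apply: (@path_intertwined _ _ _ _ _ _ _ _ (nth 0%N mu) (nth 0%N nu)) => //.
- by move=> c; apply: part_nthS.
- by move=> c; apply: part_nthS.
- exact: nth_geq_size muN _.
- exact: nth_geq_size nuN _.
Qed.

End Commutation.

(** * The branching rule for spin q-Whittaker polynomials *)

Section Branching.
Variables (C : fieldType) (q s : C).
Implicit Types (la ka : seq nat).

Definition interlacers la : seq (seq nat) :=
  [seq ka <- boxed_parts (size la) (nth 0%N la 0) |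
    all (fun c => nth 0 la c.+1 <= nth 0 ka c <= nth 0 la c)%N
        (iota 0 (size la))].

Lemma interlacersP la ka : is_part la ->
  reflect (is_part ka /\
           forall c, (nth 0 la c.+1 <= nth 0 ka c <= nth 0 la c)%N)
          (ka \in interlacers la).
Proof.
move=> pla; rewrite mem_filter mem_boxed_parts.
apply: (iffP andP) => [[/allP il /and3P[pka kaN _]]|[pka il]].
  split=> // c; case: (ltnP c (size la)) => [cN|Nc].
    by apply: il; rewrite mem_iota.
  by rewrite !(@nth_geq_size _ (size la)) // leqW.
split; first by apply/allP => c _; apply: il.
rewrite pka (andP (il 0%N)).2 part_size_leq //.
by have := il (size la); rewrite [nth 0%N la (size la)]nth_default //; lia.
Qed.

Definition ext_fun (T : Type) n (f : 'I_n -> T) (y : T) (r : 'I_n.+1) : T :=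
  if insub (val r) is Some r' then f r' else y.

Lemma ext_fun_widen (T : Type) n (f : 'I_n -> T) y r :
  ext_fun f y (widen_ord (leqnSn n) r) = f r.
Proof.
rewrite /ext_fun; case: insubP => [r' _ /= e|]; last by rewrite /= ltn_ord.
by congr f; apply: val_inj.
Qed.

Lemma ext_fun_max (T : Type) n (f : 'I_n -> T) y : ext_fun f y ord_max = y.
Proof. by rewrite /ext_fun insubF //= ltnn. Qed.

Lemma ext_fun_eta (T : Type) n (g : 'I_n.+1 -> T) :
  ext_fun (fun r => g (widen_ord (leqnSn n) r)) (g ord_max) = g.
Proof.
apply/funext => r; rewrite /ext_fun; case: insubP => [r' _ /= e|/=].
  by congr g; apply: val_inj.
rewrite -leqNgt => nr; congr g; apply/val_inj/eqP.
by rewrite /= eqn_leq nr -ltnS ltn_ord.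
Qed.

Definition restrict_config n (hv : qW_config n.+1) : qW_config n :=
  (fun r => hv.1 (widen_ord (leqnSn n) r),
   fun r => hv.2 (widen_ord (leqnSn n.+1) r)).

Definition extend_config n (hv : qW_config n) ka la : qW_config n.+1 :=
  (ext_fun hv.1 (fun c => nth 0 la c - nth 0 ka c)%N,
   ext_fun hv.2 (fun c => nth 0 la c - nth 0 la c.+1)%N).

Lemma extend_configK n (hv : qW_config n) ka la :
  restrict_config (extend_config hv ka la) = hv.
Proof.
case: hv => h v; congr pair; apply/funext => r; exact: ext_fun_widen.
Qed.

Lemma extend_config_inj n (hv hv' : qW_config n) la ka ka' :
  is_part la -> ka \in interlacers la -> ka' \in interlacers la ->
  extend_config hv ka la = extend_config hv' ka' la -> ka = ka' /\ hv = hv'.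
Proof.
move=> pla /(interlacersP _ pla)[pka il] /(interlacersP _ pla)[pka' il'] e.
split; last by rewrite -(extend_configK hv ka la) e extend_configK.
apply: part_eq => // c; have := congr1 (fun hv => hv.1 ord_max c) e.
by rewrite /= !ext_fun_max; have := il c; have := il' c; lia.
Qed.

Fixpoint qW_chains n : seq nat -> seq (qW_config n) :=
  match n with
  | 0 => fun la => if la is [::] then [:: (fun _ _ => 0%N, fun _ _ => 0%N)]
                   else [::]
  | n'.+1 => fun la => [seq extend_config hv ka la |
                         ka <- interlacers la, hv <- @qW_chains n' ka]
  end.

Lemma qW_chains_uniq n la : is_part la -> uniq (qW_chains n la).
Proof.
elim: n la => [|n IH] la pla; first by case: la pla.
apply: allpairs_uniq_dep.
- by rewrite filter_uniq // boxed_parts_uniq.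
- by move=> ka /(interlacersP _ pla)[pka _]; apply: IH.
move=> _ _ /allpairsPdep[k [v [kI _ ->]]] /allpairsPdep[k' [v' [kI' _ ->]]] /=.
by move=> /(extend_config_inj pla kI kI')[-> ->].
Qed.

Lemma qW_chains_configs n la hv : is_part la ->
  hv \in qW_chains n la -> qW_configs la hv.
Proof.
elim: n la hv => [|n IH] la hv pla.
  case: la pla => // _; rewrite inE => /eqP ->.
  by split=> // [[]|c] //; rewrite /= !nth_nil.
move=> /allpairsPdep[ka [hv' [kaI hvI ->]]].
have [pka il] := interlacersP _ pla kaI; have [ev v0 vmax] := IH _ _ pka hvI.
split=> /= [r|c|c].
- rewrite /ext_fun; case: insubP => [r' _ _|_]; first exact: ev.
  by exists (size la) => c Nc; rewrite nth_default.
- rewrite (_ : ord0 = widen_ord (leqnSn n.+1) ord0) ?ext_fun_widen ?v0 //.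
  exact: val_inj.
- by rewrite ext_fun_max.
Qed.

Definition qW_row x (h v v' : nat -> nat) : C :=
  xqpoch q s x (h 0%N) / qpoch q q (h 0%N) *
  infprod (fun c => weightW q s x (v c) (h c) (v' c) (h c.+1)).

Lemma qW_termS n (x : 'I_n.+1 -> C) (hv : qW_config n.+1) :
  qW_term q s x hv =
  qW_term q s (fun r => x (widen_ord (leqnSn n) r)) (restrict_config hv) *
  qW_row (x ord_max) (hv.1 ord_max) (hv.2 (widen_ord (leqnSn n.+1) ord_max))
    (hv.2 ord_max).
Proof.
rewrite /qW_term big_ord_recr /=; congr (_ * _).
  apply: eq_bigr => r _; congr (_ * infprod _); apply/funext => c.
  by congr weightW; congr (hv.2 _ _); apply: val_inj.
by rewrite /qW_row; congr (_ * infprod _); apply/funext => c;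
  congr weightW; congr (hv.2 _ _); apply: val_inj.
Qed.

Lemma weightW_neq0 x i j k l : weightW q s x i j k l != 0 ->
  (i + j = k + l)%N /\ (l <= i)%N.
Proof.
by rewrite /weightW; case: ifP => [/andP[/eqP -> ->] //|]; rewrite eqxx.
Qed.

Lemma qW_chains_support n (x : 'I_n -> C) la hv : is_part la ->
  qW_configs la hv -> qW_term q s x hv != 0 -> hv \in qW_chains n la.
Proof.
elim: n x la hv => [|n IH] x la hv pla [ev v0 vmax].
  (* Without rows the top and bottom labels coincide and vanish, so all parts of [la] are equal,
     hence zero. *)
  have la0 : la = [::].
    have laS c : nth 0%N la c = nth 0%N la c.+1.
      have := vmax c; rewrite (_ : ord_max = ord0) ?v0; last exact: val_inj.
      by have := part_nthS c pla; lia.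
    apply/nilP; rewrite /nilp -leqn0 part_size_leq //.
    have laE c : nth 0%N la c = nth 0%N la 0.
      by elim: c => // c <-; rewrite -laS.
    by rewrite -(laE (size la)) nth_default.
  move=> _; rewrite la0 inE; apply/eqP; case: hv ev v0 vmax => h v _ v0 _.
  congr pair; apply/funext; first by case.
  move=> r; apply/funext => c; rewrite -(v0 c).
  by congr (v _ c); apply: val_inj; case: r => [[]].
rewrite qW_termS mulf_eq0 negb_or => /andP[IHn].
rewrite /qW_row mulf_eq0 negb_or => /andP[_ /infprod_neq0 w0].
set h := hv.1 ord_max in w0 *; set v := hv.2 (widen_ord _ ord_max) in w0 *.
have {}w0 c : (v c + h c = nth 0 la c - nth 0 la c.+1 + h c.+1)%N /\
    (h c.+1 <= v c)%N.
  by have := weightW_neq0 (w0 c); rewrite vmax.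
have [M hM] := ev ord_max; pose N := maxn M (size la).
have Ngt c : (N <= c)%N -> nth 0%N la c = 0%N /\ h c = 0%N.
  by rewrite geq_max => /andP[Mc lac]; rewrite /h hM // nth_default.
have h_le c : (h c <= nth 0 la c)%N.
  have [k] := ubnP (N - c)%N; elim: k c => // k IHk c; rewrite ltnS => lek.
  have [le|lt] := leqP N c; first by have [-> ->] := Ngt c le.
  have := IHk c.+1 ltac:(lia); have := w0 c; have := part_nthS c pla; lia.
(* The partition one row below: by conservation its gaps are the labels [v], and h_{c+1} <= v_c
   gives interlacing with [la]. *)
pose f c := (nth 0 la c - h c)%N.
have fS c : (f c = f c.+1 + v c)%N.
  have := h_le c; have := h_le c.+1; have := w0 c; have := part_nthS c pla.
  by rewrite /f; lia.
have f_mono c : (f c.+1 <= f c)%N by rewrite (fS c) leq_addr.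
have fN : f N = 0%N by rewrite /f; have [-> _] := Ngt N (leqnn N).
have [pka nka] := part_ofP f_mono fN.
set ka := part_of f N in pka nka.
have kaI : ka \in interlacers la.
  apply/interlacersP => //; split=> // c; rewrite nka /f.
  have := fS c; have := w0 c; have := h_le c; have := h_le c.+1.
  by rewrite /f; lia.
have defhv : hv = extend_config (restrict_config hv) ka la.
  rewrite /extend_config /=.
  rewrite (_ : (fun c => nth 0 la c - nth 0 ka c)%N = hv.1 ord_max); last first.
    by apply/funext => c; rewrite nka /f subKn.
  rewrite (_ : (fun c => nth 0 la c - nth 0 la c.+1)%N = hv.2 ord_max); last first.
    by apply/funext => c; rewrite vmax.
  by rewrite !ext_fun_eta; case: (hv).
rewrite defhv; apply/allpairsPdep; exists ka, (restrict_config hv); split=> //.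
apply: IH IHn => //; split=> [r|c|c] /=; first exact: ev.
- rewrite -[RHS](v0 c); congr (hv.2 _ c); exact: val_inj.
- by rewrite -/v !nka (fS c) addKn.
Qed.

Lemma spin_qWhittaker_chains n (x : 'I_n -> C) la : is_part la ->
  spin_qWhittaker q s x la = \sum_(hv <- qW_chains n la) qW_term q s x hv.
Proof.
move=> pla; rewrite /spin_qWhittaker (fsbigE (qW_chains n la)).
- rewrite [LHS]big_seq_cond [RHS]big_seq_cond; apply: eq_bigl => hv.
  rewrite andbT; case hvC: (hv \in qW_chains n la) => //=.
  by apply: mem_set; apply: qW_chains_configs hvC.
- exact: qW_chains_uniq.
- by move=> hv; apply: qW_chains_configs.
- by move=> hv hvC; apply: contraNeq; apply: qW_chains_support.
Qed.

Lemma qW_row_skew x la ka :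
  (forall c, nth 0 la c.+1 <= nth 0 ka c <= nth 0 la c)%N ->
  qW_row x (fun c => nth 0 la c - nth 0 ka c)%N
    (fun c => nth 0 ka c - nth 0 ka c.+1)%N
    (fun c => nth 0 la c - nth 0 la c.+1)%N = skew_qW q s x la ka.
Proof.
move=> il; pose N := maxn (size la) (size ka).
have laN : (size la <= N)%N by rewrite leq_maxl.
have kaN : (size ka <= N)%N by rewrite leq_maxr.
rewrite (skew_qWE _ _ _ (leqW laN) (leqW kaN)) /qW_row.
under eq_bigr do rewrite -mulrA.
rewrite (prod_shift (fun c => up_weight q s x (nth 0%N la c) (nth 0%N ka c))
  (fun c => down_weight q s x (nth 0%N ka c) (nth 0%N la c.+1) /
     gap_weight q s (nth 0%N la c - nth 0%N la c.+1))).
(* The factor in front of a row is the up weight of column 0. *)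
congr (_ * _); first by rewrite /up_weight (andP (il 0%N)).2.
rewrite !(nth_geq_size laN) ?(nth_geq_size kaN) ?leqW // subnn.
rewrite down_weight_id gap_weight0 divr1 mulr1 (infprodE (N := N)); last first.
  move=> c Nc.
  rewrite !(nth_geq_size laN) ?(nth_geq_size kaN) ?leqW // /weightW /=.
  by rewrite /xqpoch big_ord0 !qpoch0 !mulr1 divr1.
apply: eq_bigr => c _; have /andP[l1 l2] := il c; have /andP[l3 l4] := il c.+1.
rewrite /weightW ifT; last by apply/andP; split; lia.
rewrite /down_weight l1 /up_weight l4 /gap_weight invf_div.
have -> : (nth 0 ka c - nth 0 ka c.+1 - (nth 0 la c.+1 - nth 0 ka c.+1) =
  nth 0 ka c - nth 0 la c.+1)%N by lia.
by rewrite !invfM; ring.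
Qed.

Lemma spin_qWhittakerS n (x : 'I_n.+1 -> C) la : is_part la ->
  spin_qWhittaker q s x la =
  \sum_(ka <- interlacers la)
    spin_qWhittaker q s (fun r => x (widen_ord (leqnSn n) r)) ka *
    skew_qW q s (x ord_max) la ka.
Proof.
move=> pla; rewrite spin_qWhittaker_chains // big_allpairs_dep.
rewrite [LHS]big_seq_cond [RHS]big_seq_cond; apply: eq_bigr => ka.
rewrite andbT => /(interlacersP _ pla)[pka il].
rewrite spin_qWhittaker_chains // big_distrl /=.
rewrite [LHS]big_seq_cond [RHS]big_seq_cond; apply: eq_bigr => hv.
rewrite andbT => hvC; have [_ _ vmax] := qW_chains_configs pka hvC.
rewrite qW_termS extend_configK -(qW_row_skew _ il) /= !ext_fun_max ext_fun_widen.
by congr (_ * qW_row _ _ _ _); apply/funext => c; apply: vmax.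
Qed.

Lemma spin_qWhittaker0 (x : 'I_0 -> C) la : is_part la ->
  spin_qWhittaker q s x la = (la == [::])%:R.
Proof.
move=> pla; rewrite spin_qWhittaker_chains //; case: la pla => [|a la] _ /=.
  by rewrite big_seq1 /qW_term big_ord0.
by rewrite big_nil.
Qed.

(** By interlacing, each variable adds at most one part. *)
Lemma spin_qWhittaker_size n (x : 'I_n -> C) la : is_part la ->
  spin_qWhittaker q s x la != 0 -> (size la <= n)%N.
Proof.
elim: n x la => [|n IH] x la pla.
  by rewrite spin_qWhittaker0 //; case: la {pla} => //=; rewrite eqxx.
rewrite spin_qWhittakerS // => F0.
have [|noka] := boolP (has (fun ka => spin_qWhittaker q s
    (fun r => x (widen_ord (leqnSn n) r)) ka != 0) (interlacers la)).
  move=> /hasP[ka /(interlacersP _ pla)[pka il] /(IH _ _ pka) kan].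
  by apply: part_size_leq => //; have := il n; rewrite (nth_geq_size kan) //; lia.
case/negP: F0; rewrite big1_seq // => ka kaI.
by move/hasPn/(_ ka kaI): noka; rewrite negbK => /eqP ->; rewrite mul0r.
Qed.

Lemma spin_qWhittaker_nil n (x : 'I_n -> C) : spin_qWhittaker q s x [::] = 1.
Proof.
elim: n x => [|n IH] x; first by rewrite spin_qWhittaker0.
rewrite spin_qWhittakerS // (_ : interlacers [::] = [:: [::]]) // big_seq1 IH.
by rewrite (@skew_qWE _ _ _ _ _ _ 0) // big_ord0 mulr1.
Qed.

(** An index list that does not depend on [la] allows the exchange of this sum with a sum over
    [la]. *)
Lemma spin_qWhittakerS_sup n (x : 'I_n.+1 -> C) la (S : seq (seq nat)) :
  is_part la -> uniq S -> (forall ka, ka \in S -> is_part ka) ->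
  {subset interlacers la <= S} ->
  spin_qWhittaker q s x la =
  \sum_(ka <- S)
    spin_qWhittaker q s (fun r => x (widen_ord (leqnSn n) r)) ka *
    skew_qW q s (x ord_max) la ka.
Proof.
move=> pla S_uniq S_part subS; rewrite spin_qWhittakerS //.
apply: eq_big_support => // [|ka].
  by rewrite filter_uniq // boxed_parts_uniq.
rewrite mulf_eq0 negb_or => /andP[_ sk].
apply/idP/idP => [|kaS]; first exact: subS.
apply/interlacersP => //; split; first exact: S_part.
by move=> c; apply: skew_qW_interlace sk.
Qed.

End Branching.

(** * Induction on the number of variables and the Pieri rule *)

Section PieriRule.
Variables (C : fieldType) (q s u : C).
Hypothesis qq_reg : forall k, 1 - q ^+ k.+1 != 0.
Hypothesis s2_reg : forall k, 1 - s ^+ 2 * q ^+ k != 0.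
Hypothesis su_reg : 1 - s * u != 0.
Implicit Types (la mu nu ka : seq nat).

Notation dual la mu := (spinHL_dual q s u (conj_part la) (conj_part mu)).

Lemma spinHL_dual_strip la mu : is_part la -> is_part mu -> dual la mu != 0 ->
  forall c, (nth 0 mu c <= nth 0 la c <= (nth 0 mu c).+1)%N.
Proof.
move=> pla pmu du c.
have F0 : spinHL q s u (conj_part la) (conj_part mu) != 0.
  by apply: contraNneq du; rewrite /spinHL_dual => ->; rewrite mulr0.
by have := spinHL_conj_strip pla pmu F0 c; lia.
Qed.

(** The strict bound by [K] leaves room for the largest part to grow by one; the box is closed under
    [interlacers], so it serves unchanged throughout the induction. *)
Lemma spin_qWhittaker_dual_sum n (x : 'I_n -> C) mu N K :
  (n <= N)%N -> is_part mu -> (size mu <= N)%N -> (nth 0 mu 0 < K)%N ->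
  \sum_(la <- boxed_parts N K) spin_qWhittaker q s x la * dual la mu =
  \prod_(i < n) ((1 + u * x i) / (1 - s * u)) * spin_qWhittaker q s x mu.
Proof.
set S := boxed_parts N K.
have S_uniq : uniq S := boxed_parts_uniq N K.
have S_part la : la \in S -> is_part la by rewrite mem_boxed_parts => /and3P[].
elim: n x mu => [|n IH] x mu nN pmu muN muK.
  rewrite big_ord0 mul1r spin_qWhittaker0 //.
  transitivity (\sum_(la <- [:: [::]]) spin_qWhittaker q s x la * dual la mu).
    apply: eq_big_support => // la; rewrite mulf_eq0 negb_or => /andP[F0 _].
    rewrite mem_boxed_parts inE; case pla: (is_part la) => /=; last first.
      by apply/esym/negbTE; apply: contraFneq pla => ->.
    move: F0; rewrite spin_qWhittaker0 //.
    by case: (la =P [::]) => [-> //|_]; rewrite eqxx.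
  rewrite big_seq1 spin_qWhittaker0 // mul1r.
  have [->|mu0] := eqVneq mu [::].
    rewrite /spinHL_dual (@spinHL_conj _ _ _ _ su_reg [::] [::] 0) //.
    by rewrite (@ctilde_conj _ _ _ [::] 0) // !big_ord0 divr1 !mulr1.
  apply/eqP; apply: contraNT mu0 => du.
  have := spinHL_dual_strip _ pmu du 0%N; rewrite nth_nil => /(_ isT) mu00.
  by apply/eqP/nilP; rewrite /nilp -leqn0 part_size_leq //; lia.
set y := fun r => x (widen_ord (leqnSn n) r); set z := x ord_max.
have inter_S la : la \in S -> {subset interlacers la <= S}.
  move=> laS ka /(interlacersP _ (S_part _ laS))[pka il]; move: laS.
  rewrite !mem_boxed_parts pka => /and3P[pla laN laK] /=; apply/andP; split.
    apply: part_size_leq => //; have := il N.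
    by rewrite !(nth_geq_size laN) ?leqW //; lia.
  by have := il 0%N; lia.
have muS : mu \in S by rewrite mem_boxed_parts pmu muN ltnW.
transitivity (\sum_(nu <- S) spin_qWhittaker q s y nu *
    \sum_(la <- S) skew_qW q s z la nu * dual la mu).
  under [RHS]eq_bigr do rewrite big_distrr /=.
  rewrite exchange_big /= [LHS]big_seq_cond [RHS]big_seq_cond.
  apply: eq_bigr => la /andP[laS _].
  rewrite (spin_qWhittakerS_sup _ _ _ (S_part _ laS) S_uniq S_part (inter_S _ laS)).
  by rewrite big_distrl; apply: eq_bigr => nu _; rewrite mulrA.
transitivity ((1 + u * z) / (1 - s * u) * \sum_(ka <- S) skew_qW q s z mu ka *
    \sum_(nu <- S) spin_qWhittaker q s y nu * dual nu ka).
  under [X in _ * X]eq_bigr do rewrite big_distrr /=.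
  rewrite exchange_big big_distrr /= [LHS]big_seq_cond [RHS]big_seq_cond.
  apply: eq_bigr => nu /andP[nuS _]; have pnu := S_part _ nuS.
  (* Only a [nu] with at most n parts matters; then every contributing [la] has at most n + 1 parts
     and stays in the box, as [skew_commutation] requires. *)
  have [->|F0] := eqVneq (spin_qWhittaker q s y nu) 0.
    by rewrite mul0r big1 ?mulr0 // => ka _; rewrite mul0r mulr0.
  have nun := spin_qWhittaker_size pnu F0.
  rewrite (skew_commutation (N := N) qq_reg s2_reg su_reg pmu pnu muN) //.
  - rewrite mulrCA; congr (_ * _); rewrite big_distrr /=.
    by apply: eq_bigr => ka _; rewrite mulrCA.
  - by move: nuS; rewrite mem_boxed_parts => /and3P[].
  - move=> la pla; rewrite mulf_eq0 negb_or => /andP[sk du].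
    rewrite mem_boxed_parts pla /=; apply/andP; split.
      apply: (leq_trans _ nN); apply: part_size_leq => //.
      by have := skew_qW_interlace n sk; rewrite (nth_geq_size nun) //; lia.
    by have := spinHL_dual_strip pla pmu du 0%N; lia.
  - move=> ka pka; rewrite mulf_eq0 negb_or => /andP[sk _].
    apply: (inter_S _ muS); apply/interlacersP => //; split=> // c.
    exact: skew_qW_interlace sk.
rewrite big_ord_recr /= [_ * (_ / _)]mulrC -[RHS]mulrA; congr (_ * _).
rewrite (spin_qWhittakerS_sup _ _ _ pmu S_uniq S_part (inter_S _ muS)).
rewrite big_distrr /= [LHS]big_seq_cond [RHS]big_seq_cond.
apply: eq_bigr => ka /andP[kaS _].
have [->|sk] := eqVneq (skew_qW q s z mu ka) 0; first by rewrite mul0r !mulr0.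
rewrite (IH y ka (ltnW nN)) ?S_part //; first by rewrite mulrC -mulrA.
  by move: kaS; rewrite mem_boxed_parts => /and3P[].
by have := skew_qW_interlace 0%N sk; lia.
Qed.

Lemma nseq1_part i : is_part (nseq i 1%N).
Proof.
apply/andP; split; last by rewrite mem_nseq andbF.
by elim: i => [|[|i] IH].
Qed.

(** The edge enters with weight u and crosses i columns with weight (u - s)/(1 - su) each. It ends
    with (1 - q)/(1 - su), where ctilde = (1 - s^2)/(1 - q) cancels 1 - q. *)
Lemma dual_column i :
  dual (nseq i.+1 1%N) [::] =
  u * (1 - s ^+ 2) / (1 - s * u) * ((u - s) / (1 - s * u)) ^+ i.
Proof.
have p1 := nseq1_part i.+1.
have sz : (size (nseq i.+1 1%N) <= i.+1)%N by rewrite size_nseq.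
rewrite /spinHL_dual (@spinHL_conj _ _ _ _ su_reg _ _ i.+1) //.
rewrite (@ctilde_conj _ _ _ [::] 0) //.
rewrite (ctilde_conj _ _ p1 sz) big_ord0 divr1 !big_ord_recr /=.
have n1 c : nth 0%N (1%N :: nseq i 1%N) c = (c <= i)%N.
  by rewrite -[_ :: _]/(nseq i.+1 1%N) nth_nseq ltnS; case: leqP.
have n2 c : nth 0%N (nseq i 1%N) c = (c < i)%N by rewrite nth_nseq; case: ltnP.
rewrite big1 => [|c _]; last by rewrite n1 n2 ltn_ord ltnW // subnn gap_weight0.
rewrite (eq_bigr (fun=> (u - s) / (1 - s * u))) => [|c _]; last first.
  by rewrite n1 n2 !nth_nil ltn_ord ltnW //= /weightw /= expr0 mulr1.
rewrite prodr_const card_ord !nth_nil n1 n2 leqnn ltnn /= /weightw /=.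
have q1 := qq_reg 0; rewrite expr1 in q1.
rewrite /gap_weight /qpoch !big_ord1 !expr0 !expr1 !mulr1; field.
by rewrite su_reg q1.
Qed.

Lemma pieri_factor n (x : 'I_n -> C) :
  \prod_(i < n) ((1 + u * x i) / (1 - s * u)) =
  1 + u * (1 - s ^+ 2) / (1 - s * u) *
    \sum_(1 <= i < n.+1)
      ((u - s) / (1 - s * u)) ^+ (i - 1) * spin_qWhittaker q s x (nseq i 1%N).
Proof.
(* A box with n rows and one column suffices over the empty partition; its partitions are the 1^i
   with i <= n. *)
have := @spin_qWhittaker_dual_sum n x [::] n 1 (leqnn n) isT isT isT.
rewrite spin_qWhittaker_nil mulr1 => <-.
transitivity (\sum_(la <- [seq nseq i 1%N | i <- iota 0 n.+1])
    spin_qWhittaker q s x la * dual la [::]).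
  apply: eq_big_support; first exact: boxed_parts_uniq.
    rewrite map_inj_uniq ?iota_uniq // => i j /(congr1 size).
    by rewrite !size_nseq.
  move=> la; rewrite mulf_eq0 negb_or => /andP[F0 du].
  rewrite mem_boxed_parts; apply/and3P/mapP => [[pla lan la0]|[m]].
    exists (size la); first by rewrite mem_iota ltnS.
    apply/part_eq => // [|c]; first exact: nseq1_part.
    rewrite nth_nseq; case: ifP => [cla|/negbT]; last first.
      by rewrite -leqNgt => /(nth_default 0%N).
    have := part_nth_gt0 c pla; rewrite cla.
    by have := part_nth_anti pla (leq0n c); lia.
  rewrite mem_iota ltnS => /andP[_ m_n] ->; rewrite nseq1_part size_nseq nth_nseq.
  by split=> //; case: ifP.
rewrite big_map -[iota 0 n.+1]/(0%N :: iota 1 n) big_cons; congr (_ + _).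
  rewrite spin_qWhittaker_nil mul1r /spinHL_dual.
  by rewrite (@spinHL_conj _ _ _ _ su_reg [::] [::] 0) // (@ctilde_conj _ _ _ [::] 0) // !big_ord0 divr1 !mulr1.
rewrite /index_iota subn1 big_distrr /= [LHS]big_seq_cond [RHS]big_seq_cond.
apply: eq_bigr => -[|i]; rewrite mem_iota //= => _.
by rewrite dual_column subn1 mulrC mulrA.
Qed.

Lemma spin_qWhittaker_pieri n (x : 'I_n -> C) mu : is_part mu ->
  finite_set [set la | is_part la /\
    spin_qWhittaker q s x la * dual la mu != 0] /\
  \sum_(la \in partitions) (spin_qWhittaker q s x la * dual la mu) =
  (1 + u * (1 - s ^+ 2) / (1 - s * u) *
    \sum_(1 <= i < n.+1)
      ((u - s) / (1 - s * u)) ^+ (i - 1) * spin_qWhittaker q s x (nseq i 1%N))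
  * spin_qWhittaker q s x mu.
Proof.
(* F bounds the number of parts by n, the dual function bounds the largest part by mu_0 + 1; the box
   must also hold [mu] itself. *)
move=> pmu; pose N := maxn n (size mu); pose K := (nth 0 mu 0).+1%N.
have supp la : is_part la -> spin_qWhittaker q s x la * dual la mu != 0 ->
    la \in boxed_parts N K.
  move=> pla; rewrite mulf_eq0 negb_or => /andP[F0 du].
  rewrite mem_boxed_parts pla leq_max (spin_qWhittaker_size pla F0) /=.
  by have := spinHL_dual_strip pla pmu du 0%N; rewrite /K; lia.
split.
  apply: (sub_finite_set _ (finite_seq (boxed_parts N K))) => la [pla G0].
  exact: supp.
rewrite -pieri_factor -(@spin_qWhittaker_dual_sum _ _ _ N K) //.
- rewrite (fsbigE (boxed_parts N K)).
  + rewrite [LHS]big_seq_cond [RHS]big_seq_cond; apply: eq_bigl => la.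
    rewrite mem_boxed_parts andbT; case pla: (is_part la) => //=.
    by rewrite [X in _ && X](_ : _ = true) ?andbT //; apply: mem_set.
  + exact: boxed_parts_uniq.
  + by move=> la /=; rewrite mem_boxed_parts => /and3P[].
  + by move=> la pla; apply: contraNeq; apply: supp.
- exact: leq_maxl.
- exact: leq_maxr.
Qed.

End PieriRule.

(** Since |a q^k| < 1, the product is not 1. The choices a = q and a = s^2 supply the regularity of
    the q-Pochhammer denominators. *)
Lemma normr_lt1_regular (R : realType) (q a : R[i]) k :
  `|q| <= 1 -> `|a| < 1 -> 1 - a * q ^+ k != 0.
Proof.
move=> q1 a1; rewrite subr_eq0; apply/eqP => /(congr1 Num.norm).
rewrite normr1 normrM normrX => e.
have : `|a| * `|q| ^+ k < 1.
  by apply: Order.POrderTheory.le_lt_trans a1; rewrite ler_piMr // exprn_ile1.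
by rewrite -e Order.POrderTheory.ltxx.
Qed.

Theorem mainTheorem11 (R : realType) (q s : R[i])
    (hq : `|q| < 1) (hs : `|s| < 1)
    (n : nat) (hn : (0 < n)%N) (mu : seq nat) (hmu : is_part mu)
    (u : R[i]) (x : 'I_n -> R[i]) (hsu : s * u != 1) :
  finite_set [set la | is_part la /\
    spin_qWhittaker q s x la
      * spinHL_dual q s u (conj_part la) (conj_part mu) != 0] /\
  \sum_(la \in partitions)
    (spin_qWhittaker q s x la
      * spinHL_dual q s u (conj_part la) (conj_part mu)) =
  (1 + u * (1 - s ^+ 2) / (1 - s * u)
       * \sum_(1 <= i < n.+1)
           ((u - s) / (1 - s * u)) ^+ (i - 1) * spin_qWhittaker q s x (nseq i 1%N))
    * spin_qWhittaker q s x mu.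
Proof.
apply: spin_qWhittaker_pieri => //.
- by move=> k; rewrite exprS normr_lt1_regular // Order.POrderTheory.ltW.
- by move=> k; rewrite normr_lt1_regular ?Order.POrderTheory.ltW //
    normrX exprn_ilt1.
- by rewrite subr_eq0 eq_sym.
Qed.
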